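(* For any graph $G$ with $\Delta(G)\geq 2$, we have $$\alpha_{\rm es}(G) \leq \frac{\Delta(G)(\Delta(G)-1)}{\Delta(G)^2+\Delta(G)(\delta(G)-1)+\delta(G)}\,n(G),$$ and this bound is sharp (that is, there exist graphs $G$ with $\Delta(G)\ge 2$ for which equality holds).
   Context: All graphs are finite and simple; $n(G)$, $\Delta(G)$ and $\delta(G)$ are the number of vertices, maximum degree and minimum degree of $G$. For $B\subseteq V(G)$, $N[B]=\bigcup_{b\in B}N[b]$ and $N(B)=N[B]- B$. A set $B\subseteq V(G)$ is an externally supported independence set (ESI-set) if $B$ is independent and every $v\in N(B)$ has a neighbor in $V(G)- N[B]$ (the empty set is an ESI-set); $\alpha_{\rm es}(G)$ is the maximum cardinality of an ESI-set of $G$. *)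

(* Defs.v *)
From mathcomp Require Import all_boot all_order all_algebra.

Set Implicit Arguments.
Unset Strict Implicit.
Unset Printing Implicit Defensive.

Record sgraph := SGraph {
  vertex :> finType;
  adj : rel vertex;
  adj_sym : symmetric adj;
  adj_irrefl : irreflexive adj
}.

Section Graph.
Variable G : sgraph.
Implicit Types (v w : G) (B : {set G}).

Definition num_vertices : nat := #|G|.

Definition degree v : nat := #|[set w | adj v w]|.

Definition max_degree : nat := \max_(v : G) degree v.

(* The neutral element #|G| exceeds every degree, so it only matters for the
   graph with no vertices, where the minimum degree is then 0. *)
Definition min_degree : nat := \big[minn/#|G|]_(v : G) degree v.

Definition closed_nbhd v : {set G} := v |: [set w | adj v w].

Definition closed_nbhds B : {set G} := \bigcup_(b in B) closed_nbhd b.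

Definition open_nbhds B : {set G} := closed_nbhds B :\: B.

Definition independent B : bool :=
  [forall v in B, forall w in B, ~~ adj v w].

Definition esi_set B : bool :=
  independent B &&
  [forall v in open_nbhds B, exists w in ~: closed_nbhds B, adj v w].

Definition alpha_es : nat := \max_(B : {set G} | esi_set B) #|B|.

End Graph.

Import GRing.Theory.
Local Open Scope ring_scope.

(* Computed in rat, so that the subtraction in (min_degree G)%:R - 1 is not
   truncated when the minimum degree is 0. *)
Definition esi_bound (G : sgraph) : rat :=
  let D : rat := (max_degree G)%:R in
  let d : rat := (min_degree G)%:R in
  D * (D - 1) / (D ^+ 2 + D * (d - 1) + d) * (num_vertices G)%:R.

(* Main.v *)
Require Import Defs.
From mathcomp Require Import all_boot all_order all_algebra.
From mathcomp Require Import zify lra.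
Import Order.TTheory GRing.Theory Num.Theory.
Local Open Scope ring_scope.

(** Let [B] be an ESI-set, [A = N(B)] and [C = V - N[B]], and write [D], [d] for
    the maximum and minimum degree.  All neighbors of [B] lie in [A], and every
    vertex of [A] has a neighbor in [C], hence at most [D - 1] neighbors in [B].
    Counting the edges between [B] and [A], and between [A] and [C], gives
    [d |B| <= (D - 1) |A|] and [|A| <= D |C|]; these bound
    [n = |B| + |A| + |C|] from below.  The path on five vertices, with its two
    ends as ESI-set, attains equality. *)

Section DoubleCounting.
Local Open Scope nat_scope.

(** Both sides are compared with the number of pairs of [X] and [Y] related by [e], summed by rows
    and then by columns. *)
Lemma leq_double_count (T : finType) (e : rel T) (X Y : {set T}) (k l : nat) :
  {in X, forall x, k <= #|[set y in Y | e x y]|} ->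
  {in Y, forall y, #|[set x in X | e x y]| <= l} ->
  k * #|X| <= l * #|Y|.
Proof.
move=> hX hY; rewrite mulnC [leqRHS]mulnC -!sum_nat_const.
apply: (@leq_trans (\sum_(x in X) \sum_(y in Y) e x y)).
  apply: leq_sum => x xX; apply: leq_trans (hX x xX) _.
  by rewrite -big_mkcondr -sum1dep_card.
rewrite exchange_big; apply: leq_sum => y yY; apply: leq_trans (hY y yY).
by rewrite -big_mkcondr -sum1dep_card.
Qed.

Lemma degree_le_max (G : sgraph) (v : G) : degree v <= max_degree G.
Proof. exact: leq_bigmax. Qed.

Lemma min_degree_le (G : sgraph) (v : G) : min_degree G <= degree v.
Proof. by rewrite /min_degree -minEnat -leEnat; apply: bigmin_le. Qed.

End DoubleCounting.

Section EsiSet.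
Local Open Scope nat_scope.
Variables (G : sgraph) (B : {set G}).
Hypothesis esiB : esi_set B.

(** Independence keeps [w] out of [B], so every edge at a vertex of [B] counts as an edge into
    N(B). *)
Lemma adj_esi_open_nbhds (b w : G) : b \in B -> adj b w -> w \in open_nbhds B.
Proof.
move=> bB bw; case/andP: esiB => /forall_inP/(_ b bB)/forall_inP indB _.
rewrite in_setD; apply/andP; split.
  by apply: contraL bw => /indB.
by apply/bigcupP; exists b; rewrite // in_setU1 inE bw orbT.
Qed.

Lemma leq_min_degree_esi :
  min_degree G * #|B| <= (max_degree G).-1 * #|open_nbhds B|.
Proof.
apply: (@leq_double_count G (@adj G)) => [b bB | a aA].
  apply: leq_trans (min_degree_le G b) _.
  apply/subset_leq_card/subsetP => w; rewrite in_set => bw.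
  by rewrite in_set bw (adj_esi_open_nbhds b).
case/andP: esiB => _ /forall_inP/(_ a aA)/exists_inP[c].
rewrite in_setC => cNB ac.
(* The neighbor [c] of [a] lies outside N[B], hence outside [B]; discarding it costs one from the
   degree and loses no neighbor in [B]. *)
apply: (@leq_trans (degree a).-1); last by have := degree_le_max G a; lia.
rewrite /degree (cardsD1 c [set w | adj a w]) in_set ac add1n /=.
apply/subset_leq_card/subsetP => b; rewrite !inE => /andP[bB ba].
rewrite adj_sym ba andbT; apply: contraNneq cNB => <-.
by apply/bigcupP; exists b; rewrite // setU11.
Qed.

Lemma card_open_nbhds_esi :
  #|open_nbhds B| <= max_degree G * #|~: closed_nbhds B|.
Proof.
(* Here [k = 1]: external support gives each vertex of N(B) at least one neighbor outside N[B]. *)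
rewrite -[leqLHS]mul1n; apply: (@leq_double_count G (@adj G)) => [a aA | c _].
  case/andP: esiB => _ /forall_inP/(_ a aA)/exists_inP[c cC ac].
  by rewrite card_gt0; apply/set0Pn; exists c; rewrite in_set cC.
apply: leq_trans (degree_le_max G c).
by apply/subset_leq_card/subsetP => a; rewrite !inE adj_sym => /andP[].
Qed.

Lemma num_vertices_nbhds :
  num_vertices G = #|B| + #|open_nbhds B| + #|~: closed_nbhds B|.
Proof.
have sB : B \subset closed_nbhds B.
  by apply/subsetP => b bB; apply/bigcupP; exists b; rewrite // setU11.
by rewrite /num_vertices -(cardsC (closed_nbhds B)) -(cardsID B) (setIidPr sB).
Qed.

End EsiSet.

Lemma card_esi_le_bound (G : sgraph) (B : {set G}) :
  (2 <= max_degree G)%N -> esi_set B -> #|B|%:R <= esi_bound G.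
Proof.
move=> D2 esiB; rewrite /esi_bound (num_vertices_nbhds G B).
have := leq_min_degree_esi G B esiB; have := card_open_nbhds_esi G B esiB.
rewrite -!(ler_nat rat) !natrM -subn1 natrB; last by lia.
rewrite !natrD; move: D2; rewrite -(ler_nat rat).
have := ler0n rat (min_degree G).
set D : rat := (max_degree G)%:R; set d : rat := (min_degree G)%:R.
set b : rat := #|B|%:R; set a : rat := #|_|%:R; set c : rat := #|_|%:R.
(* The denominator equals [D * (D - 1) + d * (D + 1)], which is positive. *)
move=> d0 D2 ac ba; rewrite mulrAC ler_pdivlMr; last by nra.
(* The weights [D + 1] and [D - 1] are chosen so that the sum of the two inequalities is
   [d * (D + 1) * b <= D * (D - 1) * (a + c)], the goal after cancelling [D * (D - 1) * b]. *)
have : 0 <= (D + 1) * ((D - 1) * a - d * b) by nra.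
have : 0 <= (D - 1) * (D * c - a) by nra.
nra.
Qed.

Lemma alpha_es_le_bound (G : sgraph) :
  (2 <= max_degree G)%N -> (alpha_es G)%:R <= esi_bound G.
Proof.
move=> D2; have esi0 : @esi_set G set0.
  apply/andP; split; first by apply/forall_inP => v; rewrite inE.
  by apply/forall_inP => v; rewrite /open_nbhds /closed_nbhds big_set0 set0D inE.
(* The maximum is attained because the empty set is an ESI-set. *)
have [|B esiB eqB] := eq_bigmax_cond (A := @esi_set G) (fun B : {set G} => #|B|).
  by apply/card_gt0P; exists set0.
rewrite (_ : alpha_es G = #|B|); last exact: eqB.
exact: card_esi_le_bound.
Qed.

Definition path5_adj : rel 'I_5 := fun i j => (i.+1 == j :> nat) || (j.+1 == i :> nat).

Lemma path5_adj_sym : symmetric path5_adj.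
Proof. by move=> i j; rewrite /path5_adj orbC. Qed.

Lemma path5_adj_irrefl : irreflexive path5_adj.
Proof. by move=> i; rewrite /path5_adj; lia. Qed.

Definition path5 : sgraph := @SGraph 'I_5 path5_adj path5_adj_sym path5_adj_irrefl.

Lemma path5_degree (i : path5) :
  degree i = if (i == ord0 :> 'I_5) || (i == ord_max :> 'I_5) then 1%N else 2%N.
Proof.
rewrite /degree -sum1dep_card big_mkcond; case: i => [[|[|[|[|[|m]]]]] im] //=;
by rewrite !big_ord_recl big_ord0.
Qed.

Lemma path5_max_degree : max_degree path5 = 2.
Proof.
rewrite /max_degree (eq_bigr _ (fun i _ => path5_degree i)).
by rewrite /= !big_ord_recl big_ord0.
Qed.

Lemma path5_min_degree : min_degree path5 = 1.
Proof.
rewrite /min_degree (eq_bigr _ (fun i _ => path5_degree i)).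
by rewrite /= card_ord !big_ord_recl big_ord0.
Qed.

(** With [D = 2], [d = 1] and five vertices, the bound is 2/5 times 5. *)
Lemma path5_esi_bound : esi_bound path5 = 2.
Proof.
by rewrite /esi_bound path5_max_degree path5_min_degree /num_vertices card_ord.
Qed.

(** The vertices 1 and 3 form N(B), and both are supported by the middle vertex 2, the only one
    outside N[B]. *)
Lemma path5_esi_ends : @esi_set path5 [set ord0; ord_max].
Proof.
apply/andP; split.
  by apply/forall_inP => v /set2P[]->; apply/forall_inP => w /set2P[]->.
have NB : @closed_nbhds path5 [set ord0; ord_max] = [set i : 'I_5 | i != 2%N :> nat].
  apply/setP => i; rewrite /closed_nbhds bigcup_setU !big_set1 !inE.
  by case: i => [[|[|[|[|[|m]]]]] im].
apply/forall_inP => v; rewrite /open_nbhds NB => vA.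
apply/exists_inP; exists (inord 2 : 'I_5); first by rewrite !inE inordK.
move: vA; rewrite !inE /= /path5_adj inordK //.
by case: v => [[|[|[|[|[|m]]]]] im].
Qed.

Theorem proposition13 :
  (forall G : sgraph, (2 <= max_degree G)%N ->
     (alpha_es G)%:R <= esi_bound G) /\
  (exists G : sgraph, (2 <= max_degree G)%N /\
     (alpha_es G)%:R = esi_bound G).
Proof.
split; first exact: alpha_es_le_bound.
exists path5; rewrite path5_max_degree; split=> //.
apply/eqP; rewrite eq_le alpha_es_le_bound ?path5_max_degree //=.
(* The remaining inequality follows from the two ends. *)
rewrite path5_esi_bound ler_nat.
apply: leq_trans (leq_bigmax_cond _ path5_esi_ends).
by rewrite cards2.
Qed.
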